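(* Let $T$ be a finite metric tree and let $X$ be a subset of $T$. Then \[ d_{\mathrm{GH}}(T,X)\ \ge\ \min\left\{\tfrac12 d_{\mathrm{H}}(T,X),\ \tfrac{\lambda(T)}{4},\ \tfrac{\operatorname{sep}\mathcal D_{\partial T}}{2}\right\}. \]
   Context: A finite metric graph is a connected metric space obtained by gluing a finite collection of segments $[0,l]$ with $l>0$ (the edges, $l$ being the length) along their endpoints to a finite set of vertices, equipped with the quotient (shortest-path) metric $d$. A finite metric tree is a finite metric graph containing no simple loop (no subset homeomorphic to a circle). $\partial T$ is the set of leaves (vertices of degree one); $\lambda(T)$ is the length of the shortest leaf edge (edge incident to a leaf). $\mathcal D_{\partial T}=\{d(v,w): v,w\in\partial T,\ v\ne w\}$ is the set of nonzero distances between leaves. For a finite set $Y\subseteq\mathbb R$, $\operatorname{sep}Y=\min_{y,y'\in Y,\,y\ne y'}|y-y'|$; a minimum over the empty set is $+\infty$. $d_{\mathrm{H}}$ is the Hausdorff distance between subsets of $T$ and $d_{\mathrm{GH}}$ is the Gromov--Hausdorff distance, where $X$ carries the metric restricted from $T$. *)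

(* Defs.v *)
From HB Require Import structures.
From mathcomp Require Import all_boot all_order all_algebra.
From mathcomp Require Import all_classical all_reals all_analysis.

Set Implicit Arguments.
Unset Strict Implicit.
Unset Printing Implicit Defensive.

Import Order.TTheory GRing.Theory Num.Theory.
Import numFieldNormedType.Exports.

Local Open Scope classical_set_scope.
Local Open Scope ring_scope.

Definition homeomorphic_sets (S U : topologicalType) (A : set S) (B : set U) :=
  exists (f : S -> U) (g : U -> S),
    [/\ set_fun A B f, set_fun B A g,
        {in A, cancel f g} & {in B, cancel g f}] /\
    {within A, continuous f} /\ {within B, continuous g}.

Definition circle (R : realType) : set (R * R) :=
  [set p | p.1 ^+ 2 + p.2 ^+ 2 = 1].

Definition has_simple_loop (R : realType) (T : topologicalType) :=
  exists A : set T, homeomorphic_sets (@circle R) A.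

(* For segments [0, len e] glued to T by the maps
   [chart e], [chain len chart x y l] says that y is reached from x by finitely
   many moves inside a single segment, of total length l; between two moves one
   may pass to any other preimage of the current point. The infimum of such l
   is the quotient (shortest-path) distance. *)
Inductive chain (R : realType) (T E : Type) (len : E -> R) (chart : E -> R -> T)
    : T -> T -> R -> Prop :=
| chain_nil x : chain len chart x x 0
| chain_move e s t y l : 0 <= s <= len e -> 0 <= t <= len e ->
    chain len chart (chart e t) y l ->
    chain len chart (chart e s) y (`|s - t| + l).

(* A presentation of the metric space T as a finite metric graph. [chart e] is
   the gluing map of the segment [0, len e]; its values outside that segment are
   irrelevant. Loops, multiple edges, vertices of degree two and the one-point
   graph without edges are allowed. By [chart_notin_vertices] and [chart_inj] only
   segment endpoints are identified, namely those sent to the same vertex. *)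
Record finite_metric_graph (R : realType) (T : metricType R) := FiniteMetricGraph {
  vertices : set T;
  edge : finType;
  len : edge -> R;
  chart : edge -> R -> T;
  finite_vertices : finite_set vertices;
  len_gt0 : forall e, 0 < len e;
  chart_src : forall e, vertices (chart e 0);
  chart_tgt : forall e, vertices (chart e (len e));
  chart_cover : forall x, vertices x \/
    exists e, exists2 t, 0 <= t <= len e & chart e t = x;
  chart_notin_vertices : forall e t, 0 < t < len e -> ~ vertices (chart e t);
  chart_inj : forall e e' t t', 0 < t < len e -> 0 < t' < len e' ->
    chart e t = chart e' t' -> e = e' /\ t = t';
  graph_connected : connected [set: T];
  graph_mdistE : forall x y,
    (mdist x y)%:E = ereal_inf [set l%:E | l in chain len chart x y]
}.

Arguments len {R T} f e.
Arguments chart {R T} f e t.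

Definition is_metric_tree (R : realType) (T : metricType R)
    (G : finite_metric_graph T) := ~ has_simple_loop R T.

Definition edge_end (R : realType) (T : metricType R)
    (G : finite_metric_graph T) (e : edge G) (b : bool) : T :=
  chart G e (if b then len G e else 0).

Arguments edge_end {R T} G e b.

(* Edge ends are counted, so a loop contributes two. *)
Definition degree (R : realType) (T : metricType R)
    (G : finite_metric_graph T) (v : T) : nat :=
  #|[pred p : edge G * bool | `[< edge_end G p.1 p.2 = v >]]|.

Definition leaves (R : realType) (T : metricType R)
    (G : finite_metric_graph T) : set T :=
  [set v | vertices G v /\ degree G v = 1%N].

Definition leaf_edges (R : realType) (T : metricType R)
    (G : finite_metric_graph T) : set (edge G) :=
  [set e | exists b, leaves G (edge_end G e b)].

Arguments leaf_edges {R T} G _.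

Definition shortest_leaf_edge (R : realType) (T : metricType R)
    (G : finite_metric_graph T) : \bar R :=
  ereal_inf [set (len G e)%:E | e in leaf_edges G].

Definition leaf_dists (R : realType) (T : metricType R)
    (G : finite_metric_graph T) : set R :=
  [set r | exists v w, [/\ leaves G v, leaves G w, v <> w & r = mdist v w]].

Definition sep (R : realType) (Y : set R) : \bar R :=
  ereal_inf [set r | exists y y', [/\ Y y, Y y', y <> y' & r = `|y - y'|%:E]].

(* Infimum of the r > 0 such that each set lies in the open r-neighbourhood of
   the other: +oo if exactly one set is empty, 0 if both are. *)
Definition hausdorff_dist (R : realType) (M : metricType R) (A B : set M)
    : \bar R :=
  ereal_inf [set r%:E | r in [set r : R | [/\ 0 < r,
    A `<=` \bigcup_(b in B) ball b r & B `<=` \bigcup_(a in A) ball a r]]].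

Definition isometric_on (R : realType) (M Z : metricType R) (A : set M)
    (f : M -> Z) :=
  forall x y, A x -> A y -> mdist (f x) (f y) = mdist x y.

(* A and B carry the metrics restricted from M and N; the infimum is over all
   isometric embeddings of A and B into a common metric space Z. *)
Definition gromov_hausdorff_dist (R : realType) (M N : metricType R)
    (A : set M) (B : set N) : \bar R :=
  ereal_inf [set r | exists (Z : metricType R) (f : M -> Z) (g : N -> Z),
    [/\ isometric_on A f, isometric_on B g &
        r = hausdorff_dist (f @` A) (g @` B)]].

(* Main.v *)
(** Let [GH] be smaller than the minimum, witnessed at radius [r]. It gives a map
    [F] from [T] to [X] of distortion less than [2r], and a point [p] at distance
    at least [2r] from [X]. Since [T] is connected and [F] is coarsely continuous,
    [X] lies on one side of [p], so some leaf [v0] is behind [p] as seen from all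
    of [X].

    The Gromov product of two leaves based at a third one is at least the length
    of a leaf edge, so by the bound on [r] no image of a leaf lies between two
    others. Each [F v] can thus be pushed away from all the others to a leaf
    [f v], and [d(f v, f w) = d(f v, F v) + d(F v, F w) + d(F w, f w)]. This
    exceeds [d(v, w) - 2r], hence is at least [d(v, w)] by the separation of the
    leaf distances. So [f] permutes the finite set of leaves without decreasing
    distances; it therefore preserves them, and [d(f v, F v) < 2r] for all [v].
    For [f v = v0] this contradicts [d(v0, F v) >= d(p, F v) >= 2r].

    The needed tree geometry is that of a compact geodesic space without
    embedded circles. Its basic fact is that, if two arcs from [c] to [x] and [y]
    meet only at [c], then every arc from [x] to [y] passes through [c]. *)

Require Import Defs.
From HB Require Import structures.
From mathcomp Require Import all_boot all_order all_algebra.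
From mathcomp Require Import all_classical all_reals all_analysis.
From mathcomp Require Import ring lra.

Set Implicit Arguments.
Unset Strict Implicit.
Unset Printing Implicit Defensive.

Import Order.TTheory GRing.Theory Num.Theory.
Import numFieldNormedType.Exports.

Local Open Scope classical_set_scope.
Local Open Scope ring_scope.

(** * Loops and arcs *)

Lemma within_continuous_eq (S U : topologicalType) (A : set S) (f g : S -> U) :
  (forall x, A x -> f x = g x) -> continuous f -> {within A, continuous g}.
Proof.
move=> fg cf; apply: (@subspace_eq_continuous _ _ _ f).
  by move=> x; rewrite inE => /fg.
exact: continuous_subspaceT.
Qed.

Lemma homeomorphic_compact_image (S U : topologicalType) (A : set S)
    (f : S -> U) :
  A !=set0 -> compact A -> hausdorff_space U -> {within A, continuous f} ->
  {in A &, injective f} -> homeomorphic_sets A (f @` A).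
Proof.
move=> [a0 Aa0] cptA hU cf injf.
have gP u : exists s, (f @` A) u -> A s /\ f s = u.
  by have [[s As <-]|nu] := pselect ((f @` A) u); [exists s|exists a0].
pose g u := projT1 (cid (gP u)).
have gE u : (f @` A) u -> A (g u) /\ f (g u) = u by exact: (projT2 (cid (gP u))).
have gK s : A s -> g (f s) = s.
  move=> As; have [|Ag fg] := gE (f s); first by exists s.
  by apply: injf; rewrite ?inE.
exists f, g; split.
  split.
  - by move=> s As; exists s.
  - by move=> u ufA; exact: (gE u ufA).1.
  - by move=> s; rewrite inE => /gK.
  - by move=> u; rewrite inE => ufA; exact: (gE u ufA).2.
split => //; apply/continuous_closedP => C cC; apply/closed_subspaceP.
exists (f @` (A `&` C)).
  apply: compact_closed => //; apply: continuous_compact.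
    by apply: continuous_subspaceW cf => x [].
  exact: compact_closedI.
apply/seteqP; split => u /=.
- move=> [[s [As Cs] <-] _]; split; last by exists s.
  by change (C (g (f s))); rewrite gK.
- move=> [Cu Au]; split => //; have [Ag fg] := gE u Au.
  by exists (g u).
Qed.

Lemma closed_circle (R : realType) : closed (@circle R).
Proof.
have -> : @circle R = (fun p : R * R => p.1 ^+ 2 + p.2 ^+ 2) @^-1` [set 1].
  by [].
apply: closed_comp; last exact: closed_eq.
move=> p _; apply: (@continuousD _ _ _ (fun p : R * R => p.1 ^+ 2)).
  apply: (@continuous_comp _ _ _ fst (fun x : R => x ^+ 2)).
    exact: cvg_fst.
  exact: exprn_continuous.
apply: (@continuous_comp _ _ _ snd (fun x : R => x ^+ 2)).
  exact: cvg_snd.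
exact: exprn_continuous.
Qed.

Lemma compact_circle (R : realType) : compact (@circle R).
Proof.
have H : compact ((`[-1, 1]%classic : set R) `*` (`[-1, 1]%classic : set R)).
  by apply: compact_setX; exact: segment_compact.
have K : @circle R `<=` ((`[-1, 1]%classic : set R) `*` (`[-1, 1]%classic : set R)).
  move=> [x y]; rewrite /circle/= => h.
  by split => /=; rewrite in_itv/=; apply/andP; split; nra.
exact: subclosed_compact (@closed_circle R) H K.
Qed.

(** The circle is mapped by its first coordinate: the upper half runs along [a], the open lower half
    along [b]. *)
Lemma loop_of_arcs (R : realType) (T : topologicalType) (a b : R -> T) :
  hausdorff_space T -> continuous a -> continuous b ->
  {in `[-1, 1] &, injective a} -> {in `[-1, 1] &, injective b} ->
  a (-1) = b (-1) -> a 1 = b 1 ->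
  (forall s t, s \in `[-1, 1] -> t \in `[-1, 1] -> a s = b t ->
    (s = -1 /\ t = -1) \/ (s = 1 /\ t = 1)) ->
  has_simple_loop R T.
Proof.
move=> hT ca cb ia ib abN1 ab1 ab.
pose f (p : R * R) := if 0 <= p.2 then a p.1 else b p.1.
exists (f @` @circle R); apply: homeomorphic_compact_image => //.
- by exists (1, 0); rewrite /circle/= expr1n expr0n addr0.
- exact: compact_circle.
- pose C1 := @circle R `&` snd @^-1` [set y | 0 <= y].
  pose C2 := @circle R `&` snd @^-1` [set y | y <= 0].
  have -> : @circle R = C1 `|` C2.
    apply/seteqP; split => [p cp|p [[]|[]]//].
    by have [h|/ltW h] := leP 0 p.2; [left|right].
  apply: withinU_continuous.
  + apply: closedI; first exact: closed_circle.
    by apply: closed_comp; [move=> p _; exact: cvg_snd|exact: closed_ge].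
  + apply: closedI; first exact: closed_circle.
    by apply: closed_comp; [move=> p _; exact: cvg_snd|exact: closed_le].
  + apply: (@within_continuous_eq _ _ _ (a \o fst)).
      by move=> [x y] [_ /= y0]; rewrite /f/= y0.
    by move=> p; apply: continuous_comp; [exact: cvg_fst|exact: ca].
  + apply: (@within_continuous_eq _ _ _ (b \o fst)).
      move=> [x y] [/= h y0]; rewrite /circle/= in h.
      (* On the closed lower half [f] still uses [a] at height 0; there the abscissa is 1 or -1,
         where [a] and [b] agree. *)
      rewrite /f/=; case: ifPn => // y0'; have {y0' y0}y0 : y = 0 by lra.
      have /eqP : (x - 1) * (x + 1) = 0 by rewrite y0 in h; lra.
      rewrite mulf_eq0 => /orP[]/eqP x1.
        by have -> : x = 1 by lra.
      by have -> : x = -1 by lra.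
    by move=> p; apply: continuous_comp; [exact: cvg_fst|exact: cb].
- have half (y y' : R) : y ^+ 2 = y' ^+ 2 -> 0 <= y * y' -> y = y'.
    move=> /eqP; rewrite eqf_sqr => /orP[/eqP//|/eqP ->] h.
    have /eqP : y' ^+ 2 = 0 by nra.
    by rewrite sqrf_eq0 => /eqP ->; rewrite oppr0.
  move=> [x y] [x' y']; rewrite !inE /circle /f/= => h h'.
  have x1 : x \in `[-1, 1] by rewrite in_itv/=; apply/andP; split; nra.
  have x1' : x' \in `[-1, 1] by rewrite in_itv/=; apply/andP; split; nra.
  have [y0|y0] := leP 0 y; have [y0'|y0'] := leP 0 y'.
  + move=> /ia -/(_ x1 x1') E; subst x'; congr pair; apply: half; nra.
  + by move=> /ab -/(_ x1 x1')[[? ?]|[? ?]]; subst;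
      clear -h h' y0 y0'; exfalso; nra.
  + by move=> /esym /ab -/(_ x1' x1)[[? ?]|[? ?]]; subst;
      clear -h h' y0 y0'; exfalso; nra.
  + move=> /ib -/(_ x1 x1') E; subst x'; congr pair; apply: half; nra.
Qed.

(* Continuity is required on the whole line, so that no subspace topology is
   needed; the values outside [0, 1] are irrelevant. *)
Definition arc (R : realType) (T : topologicalType) (x y : T) (a : R -> T) :=
  [/\ continuous a, {in `[0, 1] &, injective a}, a 0 = x & a 1 = y].

Lemma continuous_glue (R : realType) (T : topologicalType) (a b : R -> T) :
  continuous a -> continuous b -> a 0 = b 0 ->
  continuous (fun t : R => if t <= 0 then a t else b t).
Proof.
move=> ca cb ab0; apply/continuous_subspace_setT.
have -> : [set: R] = [set x | x <= 0] `|` [set x | 0 <= x].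
  apply/seteqP; split => // x _ /=.
  by have [h|/ltW h] := leP x 0; [left|right].
apply: withinU_continuous; [exact: closed_le|exact: closed_ge| |].
- by apply: (@within_continuous_eq _ _ _ a) => // x /= ->.
- apply: (@within_continuous_eq _ _ _ b) => // x /= x0.
  case: ifPn => // x0'.
  by have -> : x = 0 by lra.
Qed.

Lemma continuous_affine (R : realType) (T : topologicalType) (a : R -> T)
    (u v : R) : continuous a -> continuous (fun s : R => a (u + v * s)).
Proof.
move=> ca s; apply: (@continuous_comp _ _ _ (fun s : R => u + v * s) a).
  apply: continuousD; first exact: cst_continuous.
  by apply: continuousM; [exact: cst_continuous|exact: cvg_id].
exact: ca.
Qed.

Lemma exists_first (R : realType) (A : set R) :
  A !=set0 -> compact A -> exists2 m, A m & forall t, A t -> m <= t.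
Proof.
move=> A0 cA.
have [|m] := compact_EVT_min A0 cA (f := id).
  by apply: continuous_subspaceT => x; exact: cvg_id.
by rewrite inE => Am h; exists m => // t At; apply: h; rewrite inE.
Qed.

Lemma exists_last (R : realType) (A : set R) :
  A !=set0 -> compact A -> exists2 m, A m & forall t, A t -> t <= m.
Proof.
move=> A0 cA.
have [|m] := compact_EVT_max A0 cA (f := id).
  by apply: continuous_subspaceT => x; exact: cvg_id.
by rewrite inE => Am h; exists m => // t At; apply: h; rewrite inE.
Qed.

(* Otherwise the stretch of [e] between its last visit to [a] and its first visit
   to [b] closes up to a loop with parts of [a] and [b]. *)
Lemma arc_through (R : realType) (T : topologicalType) (c x y : T)
    (a b e : R -> T) :
  hausdorff_space T -> ~ has_simple_loop R T ->
  arc c x a -> arc c y b -> arc x y e ->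
  (forall s t, s \in `[0, 1] -> t \in `[0, 1] -> a s = b t -> s = 0) ->
  exists2 s, s \in `[0, 1] & e s = c.
Proof.
move=> hT noloop [ca ia a0 a1] [cb ib b0 b1] [ce ie e0 e1] ab.
have I0 : (0 : R) \in `[0, 1] by rewrite in_itv/=; lra.
have I1 : (1 : R) \in `[0, 1] by rewrite in_itv/=; lra.
have ab' s t : s \in `[0, 1] -> t \in `[0, 1] -> a s = b t -> s = 0 /\ t = 0.
  move=> s01 t01 E; have s0 := ab _ _ s01 t01 E; split => //.
  by apply: ib => //; rewrite -E s0 a0 b0.
have [//|noc] := pselect (exists2 s, s \in `[0, 1] & e s = c).
have {noc}noc s : s \in `[0, 1] -> e s <> c by move=> s01 E; apply: noc; exists s.
exfalso; apply: noloop.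
have cimg (h : R -> T) u v : continuous h -> compact (h @` `[u, v]).
  move=> ch; apply: continuous_compact; last exact: segment_compact.
  exact: continuous_subspaceT.
have cpre (h : R -> T) u v (K : set T) : continuous h -> compact K ->
    compact (`[u, v] `&` h @^-1` K).
  move=> ch cK; apply: compact_closedI; first exact: segment_compact.
  by apply: closed_comp; [move=> z _; exact: ch|exact: compact_closed].
(* The first visit [s2] to [b] is chosen before [s1], the last visit to [a] up to time [s2]. Hence
   [e] meets neither arc strictly between [s1] and [s2]. *)
have [|t2' [s2I [t2 t2I be2]] s2min] :=
  exists_first _ (cpre e 0 1 _ ce (cimg b 0 1 cb)).
  by exists 1; split => //=; exists 1 => //; rewrite b1 e1.
set s2 := t2' in s2I be2 s2min.
have [|t1' [s1I [t1 t1I ae1]] s1max] :=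
  exists_last _ (cpre e 0 s2 _ ce (cimg a 0 1 ca)).
  exists 0; split => /=; last by exists 1 => //; rewrite a1 e0.
  by move: s2I; rewrite /= !in_itv/=; lra.
set s1 := t1' in s1I ae1 s1max.
move: s2I s1I t2I t1I; rewrite /= !in_itv/= => s2I s1I t2I t1I.
have s1I' : s1 \in `[0, 1] by rewrite in_itv/=; lra.
have s2I' : s2 \in `[0, 1] by rewrite in_itv/=; lra.
have t2_gt0 : 0 < t2.
  rewrite lt_neqAle (andP t2I).1 andbT; apply/eqP => t20.
  by apply: (noc s2) => //; rewrite -be2 -t20 b0.
have t1_gt0 : 0 < t1.
  rewrite lt_neqAle (andP t1I).1 andbT; apply/eqP => t10.
  by apply: (noc s1) => //; rewrite -ae1 -t10 a0.
have s12 : s1 < s2.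
  rewrite lt_neqAle (andP s1I).2 andbT; apply/eqP => s12.
  have [] := ab' t1 t2; rewrite ?in_itv//= ?ae1 ?be2 ?s12// => t10.
  by rewrite t10 ltxx in t1_gt0.
(* On [[- t1, t2]], [g] runs back along [a] from [e s1] to [c], then along [b] to [e s2]. *)
pose g (t : R) := if t <= 0 then a (0 + -1 * t) else b t.
have cg : continuous g.
  apply: (@continuous_glue _ _ (fun t => a (0 + -1 * t))) => //.
    exact: continuous_affine.
  by rewrite mulr0 addr0 a0 b0.
have ig (t t' : R) : - t1 <= t <= t2 -> - t1 <= t' <= t2 -> g t = g t' -> t = t'.
  rewrite /g => tI tI'.
  have [t0|t0] := leP t 0; have [t0'|t0'] := leP t' 0.
  - by move=> /ia; rewrite !in_itv/= => E; have := E ltac:(lra) ltac:(lra); lra.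
  - by move=> /ab'; rewrite !in_itv/= => E; have := E ltac:(lra) ltac:(lra); lra.
  - move=> /esym/ab'; rewrite !in_itv/= => E.
    by have := E ltac:(lra) ltac:(lra); lra.
  - by move=> /ib; rewrite !in_itv/= => E; have := E ltac:(lra) ltac:(lra); lra.
have eg (s t : R) : s1 <= s <= s2 -> - t1 <= t <= t2 -> e s = g t ->
    (s = s1 /\ t = - t1) \/ (s = s2 /\ t = t2).
  rewrite /g => sI tI; have [t0|t0] := leP t 0 => E.
  - left; have s1s : s <= s1.
      apply: s1max; split => /=; first by rewrite in_itv/=; lra.
      by exists (0 + -1 * t) => //; rewrite in_itv/=; lra.
    have ss1 : s = s1 by lra.
    split => //; move: E; rewrite ss1 -ae1 => /ia; rewrite !in_itv/= => E.
    by have := E ltac:(lra) ltac:(lra); lra.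
  - right; have s2s : s2 <= s.
      apply: s2min; split => /=; first by rewrite in_itv/=; lra.
      by exists t => //; rewrite in_itv/=; lra.
    have ss2 : s = s2 by lra.
    split => //; move: E; rewrite ss2 -be2 => /ib; rewrite !in_itv/= => E.
    by have := E ltac:(lra) ltac:(lra); lra.
(* Half-lengths of the two parameter intervals, used to rescale both to [[-1, 1]]. *)
pose ve := (s2 - s1) / 2; pose vg := (t2 + t1) / 2.
have ve0 : 0 < ve by rewrite /ve; lra.
have vg0 : 0 < vg by rewrite /vg; lra.
have inj (v u s t : R) : 0 < v -> u + v * s = u + v * t -> s = t.
  by move=> v0 /addrI; apply: mulfI; rewrite gt_eqF.
have rng (v u w s : R) : 0 < v -> u - v = w -> s \in `[-1, 1] ->
    w <= u + v * s <= w + v + v.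
  by move=> v0 <-; rewrite in_itv/= => /andP[? ?]; apply/andP; split; nra.
apply: (@loop_of_arcs _ _ (fun s => e ((s1 + s2) / 2 + ve * s))
  (fun s => g ((t2 - t1) / 2 + vg * s))) => //.
- exact: continuous_affine.
- exact: continuous_affine.
- move=> s t sI tI /ie E; apply: (inj ve ((s1 + s2) / 2)) => //; apply: E.
    have := rng ve ((s1 + s2) / 2) s1 s ve0 _ sI; rewrite in_itv/= /ve; lra.
  have := rng ve ((s1 + s2) / 2) s1 t ve0 _ tI; rewrite in_itv/= /ve; lra.
- move=> s t sI tI /ig E; apply: (inj vg ((t2 - t1) / 2)) => //; apply: E.
    have := rng vg ((t2 - t1) / 2) (- t1) s vg0 _ sI; rewrite /vg; lra.
  have := rng vg ((t2 - t1) / 2) (- t1) t vg0 _ tI; rewrite /vg; lra.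
- have -> : (s1 + s2) / 2 + ve * -1 = s1 by rewrite /ve; lra.
  have -> : (t2 - t1) / 2 + vg * -1 = - t1 by rewrite /vg; lra.
  rewrite -ae1 /g ifT; last lra.
  by congr a; lra.
- have -> : (s1 + s2) / 2 + ve * 1 = s2 by rewrite /ve; lra.
  have -> : (t2 - t1) / 2 + vg * 1 = t2 by rewrite /vg; lra.
  by rewrite -be2 /g leNgt t2_gt0.
- move=> s t sI tI E.
  have := eg _ _ _ _ E.
  have := rng ve ((s1 + s2) / 2) s1 s ve0 _ sI.
  have := rng vg ((t2 - t1) / 2) (- t1) t vg0 _ tI.
  move=> r1 r2 H.
  have := H ltac:(rewrite /ve in r2 *; lra) ltac:(rewrite /vg in r1 *; lra).
  move=> [] [h1 h2]; [left|right]; split.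
  + by apply: (inj ve ((s1 + s2) / 2)) => //; rewrite h1 /ve; lra.
  + by apply: (inj vg ((t2 - t1) / 2)) => //; rewrite h2 /vg; lra.
  + by apply: (inj ve ((s1 + s2) / 2)) => //; rewrite h1 /ve; lra.
  + by apply: (inj vg ((t2 - t1) / 2)) => //; rewrite h2 /vg; lra.
Qed.

(** * Geodesics in compact convex metric spaces *)

Lemma mdist_triangle_abs (R : realType) (T : metricType R) (x u v : T) :
  `|mdist x u - mdist x v| <= mdist u v.
Proof.
have := metric_triangle x u v; have := metric_triangle x v u.
by rewrite (metric_sym v u) ler_norml => ? ?; apply/andP; split; lra.
Qed.

Lemma continuous_mdist (R : realType) (T : metricType R) (x : T) :
  continuous (mdist x : T -> R).
Proof.
move=> u; apply/cvgrPdist_lt => e e0.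
apply/metricType_numDomainType.nbhs_mdistP; exists e => //= v /= uv.
exact: le_lt_trans (mdist_triangle_abs x u v) uv.
Qed.

Lemma continuous_1lipschitz (R : realType) (T : metricType R) (f : R -> T) :
  (forall s t, mdist (f s) (f t) <= `|s - t|) -> continuous f.
Proof.
move=> lf s; apply/metricType_numDomainType.cvgrPdist_lt => e e0.
near=> t; apply: le_lt_trans (lf s t) _.
by near: t; apply: cvgr_dist_lt => //; exact: cvg_id.
Unshelve. all: by end_near. Qed.

(** For [0 <= l] this is the retraction of the line onto [[0, l]]. It turns maps given on a segment
    into maps continuous on the whole line, as [arc] demands. *)
Definition clamp (R : realType) (l t : R) : R :=
  if t <= 0 then 0 else if t <= l then t else l.

Lemma clampP (R : realType) (l t : R) : 0 <= l -> 0 <= clamp l t <= l.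
Proof.
rewrite /clamp => l0; have [t0|t0] := leP t 0; first by rewrite lexx.
by have [tl|tl] := leP t l; apply/andP; split; lra.
Qed.

Lemma clamp_id (R : realType) (l t : R) : 0 <= t <= l -> clamp l t = t.
Proof.
rewrite /clamp => /andP[t0 tl]; have [t0'|t0'] := leP t 0; first by lra.
by rewrite tl.
Qed.

Lemma clamp_1lipschitz (R : realType) (l s t : R) : 0 <= l ->
  `|clamp l s - clamp l t| <= `|s - t|.
Proof.
rewrite /clamp => l0.
by have [s0|s0] := leP s 0; have [t0|t0] := leP t 0;
  have [sl|sl] := leP s l; have [tl|tl] := leP t l;
  rewrite ler_norml; have [h|h] := ger0P (s - t); apply/andP; split; lra.
Qed.

Definition between (R : realType) (T : metricType R) (x z y : T) :=
  mdist x y = mdist x z + mdist z y.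

Lemma betweenC (R : realType) (T : metricType R) (x z y : T) :
  between x z y -> between y z x.
Proof.
by rewrite /between (metric_sym y x) (metric_sym y z) (metric_sym z x) addrC.
Qed.

Definition metrically_convex (R : realType) (T : metricType R) :=
  forall (x y : T) s, 0 <= s <= mdist x y ->
    exists z, mdist x z = s /\ mdist z y = mdist x y - s.

(* Equality then holds by the triangle inequality: [C] embeds isometrically
   into the line by the distance to [x]. *)
Definition collinear_from (R : realType) (T : metricType R) (x : T)
    (C : set T) :=
  forall u v, C u -> C v -> mdist u v <= `|mdist x u - mdist x v|.

Lemma collinear_from_le (R : realType) (T : metricType R) (x : T) (C : set T)
    (u v : T) : collinear_from x C -> C u -> C v -> mdist x u <= mdist x v ->
  mdist u v = mdist x v - mdist x u.
Proof.
move=> lC Cu Cv uv; have := lC _ _ Cu Cv.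
have := mdist_triangle_abs x u v.
by rewrite ler0_norm; lra.
Qed.

Lemma collinear_from_closure (R : realType) (T : metricType R) (x : T)
    (C : set T) : collinear_from x C -> collinear_from x (closure C).
Proof.
move=> lC u v clu clv; apply/ler_addgt0Pr => e e0.
(* Each of the two approximations costs twice: once in [mdist u v] and once in the difference of the
   distances to [x]. *)
have near_pt w : closure C w -> exists2 w', C w' & mdist w w' < e / 4.
  move=> /(_ (ball w (e / 4))) []; first by apply: nbhsx_ballx; lra.
  by move=> w' [Cw' ]; rewrite ballEmdist /= => ?; exists w'.
have [u' Cu' uu'] := near_pt u clu; have [v' Cv' vv'] := near_pt v clv.
have := lC _ _ Cu' Cv'.
have := metric_triangle u u' v; have := metric_triangle u' v' v.
have := mdist_triangle_abs x u u'; have := mdist_triangle_abs x v v'.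
rewrite (metric_sym v' v) !ler_norml.
have [h|h] := ger0P (mdist x u - mdist x v);
  by have [h'|h'] := ger0P (mdist x u' - mdist x v'); lra.
Qed.

(* A maximal set collinear from [x] and containing [x], [z], [y] is closed, and
   a gap in it could be filled. *)
Lemma exists_collinear_segment (R : realType) (T : metricType R) (x z y : T) :
  compact [set: T] -> metrically_convex T -> between x z y ->
  exists C : set T, [/\ collinear_from x C, C x, C z, C y &
    forall s, 0 <= s <= mdist x y -> exists2 u, C u & mdist x u = s].
Proof.
move=> cT cvxT xzy.
pose B := [set x; z; y].
have D0 := mdist_ge0 x y; have xz0 := mdist_ge0 x z; have zy0 := mdist_ge0 z y.
rewrite /between in xzy.
have linB : collinear_from x B.
  have yx := metric_sym y x; have zx := metric_sym z x.
  have yz := metric_sym y z.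
  move=> u v [[]|] -> [[]|] ->; rewrite ?mdistxx ?normr_ge0//;
    first [apply: le_trans (ler_norm _); lra
          |rewrite distrC; apply: le_trans (ler_norm _); lra].
(* Adjoining [B] inside [P], instead of requiring [B] to be a subset of [C], lets the empty union
   satisfy [P] in Zorn's lemma. Maximality then yields that [B] lies in [A]. *)
pose P (C : set T) := collinear_from x (C `|` B) /\
  forall u, C u -> mdist x u <= mdist x y.
have [F FP totF|A [[linA leA] maxA]] := @Zorn_bigcup T P.
  split; last by move=> u [C FC Cu]; exact: (FP C FC).2.
  move=> u v [[C FC Cu]|Bu] [[C' FC' C'v]|Bv].
  - have [CC'|C'C] := totF _ _ FC FC'.
      by apply: (FP C' FC').1; left => //; exact: CC'.
    by apply: (FP C FC).1; left => //; exact: C'C.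
  - by apply: (FP C FC).1; [left|right].
  - by apply: (FP C' FC').1; [right|left].
  - exact: linB.
have {}maxA C : A `<=` C -> P C -> C `<=` A.
  move=> AC PC; apply: contrapT => CA.
  exact: (maxA C (conj AC CA) PC).
have leB u : B u -> mdist x u <= mdist x y.
  by move=> [[]|] ->; rewrite ?mdistxx//; lra.
have BA : B `<=` A.
  apply: subset_trans (maxA (A `|` B) _ _); first by move=> u; right.
    by move=> u; left.
  split; first by rewrite -setUA setUid.
  by move=> u [/leA|/leB].
have AUB : A `|` B = A by apply/setUidPl.
rewrite AUB in linA.
have clA : closed A.
  apply/closure_id/seteqP; split; first exact: subset_closure.
  apply: maxA; first exact: subset_closure.
  rewrite /P; have -> : closure A `|` B = closure A.
    by apply/setUidPl; apply: subset_trans BA _; exact: subset_closure.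
  split; first exact: collinear_from_closure.
  have clD : closed [set u | mdist x u <= mdist x y].
    have -> : [set u | mdist x u <= mdist x y] =
      mdist x @^-1` [set t | t <= mdist x y] by [].
    by apply: closed_comp; [move=> u _; exact: continuous_mdist|exact: closed_le].
  by move=> u /(closure_subset leA); move: clD => /closure_id <-.
have cA : compact A by exact: subclosed_compact cT _.
exists A; split => //; try by apply: BA; rewrite /B/=; tauto.
move=> s sI.
have cimg : compact (mdist x @` A).
  apply: continuous_compact => //.
  by apply: continuous_subspaceT; exact: continuous_mdist.
(* [u] and [v] bound the possible gap of [A] around the distance [s]; convexity gives a point [w]
   between them at distance exactly [s] from [x]. *)
have [|_ [[u Au <-] us] umax] := exists_last _
    (compact_closedI cimg (@closed_le R s)).
  exists 0; split => /=; last lra.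
  by exists x; rewrite ?mdistxx//; apply: BA; left; left.
have [|_ [[v Av <-] sv] vmin] := exists_first _
    (compact_closedI cimg (@closed_ge R s)).
  by exists (mdist x y); split => /=; [exists y => //; apply: BA; right|lra].
move: us sv => /= us sv.
have uv : mdist u v = mdist x v - mdist x u.
  by apply: collinear_from_le linA _ _ _ => //; lra.
have [|w [uw wv]] := cvxT u v (s - mdist x u); first by lra.
have xw : mdist x w = s.
  by have := metric_triangle x u w; have := metric_triangle x w v; lra.
exists w => //; apply: (maxA (A `|` [set w])); last by right.
  by move=> ?; left.
(* No point of [A] lies strictly inside the gap, so the distance from [c] to [w] is estimated
   through [u] or through [v]. *)
have linw c : A c -> mdist c w <= `|mdist x c - mdist x w|.
  move=> Ac; rewrite xw; have [cs|cs] := leP (mdist x c) s.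
    have cu : mdist x c <= mdist x u by apply: umax; split => //; exists c.
    have := collinear_from_le linA Ac Au cu; have := metric_triangle c u w.
    by rewrite ler0_norm; lra.
  have vc : mdist x v <= mdist x c by apply: vmin; split => /=; [exists c|lra].
  have := collinear_from_le linA Av Ac vc; have := metric_triangle c v w.
  by rewrite (metric_sym c v) (metric_sym v w) gtr0_norm; lra.
split.
  rewrite -setUA (setUC [set w]) setUA AUB.
  move=> c c' [Ac|->] [Ac'|->].
  - exact: linA.
  - exact: linw.
  - by rewrite metric_sym distrC; exact: linw.
  - by rewrite mdistxx.
by move=> c [/leA//|->]; lra.
Qed.

(** The distance to [x] identifies a full collinear set with [[0, mdist x y]]. Its inverse, rescaled
    to [[0, 1]], is the arc. *)
Lemma exists_geodesic_through (R : realType) (T : metricType R) (x z y : T) :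
  compact [set: T] -> metrically_convex T -> between x z y -> x <> y ->
  exists e : R -> T, [/\ arc x y e,
    forall s, s \in `[0, 1] -> between x (e s) y,
    collinear_from x (range e) & exists2 s, s \in `[0, 1] & e s = z].
Proof.
move=> cT cvxT xzy /eqP xy.
have D0 : 0 < mdist x y by rewrite mdist_gt0.
have xz0 := mdist_ge0 x z; have zy0 := mdist_ge0 z y.
have [C [linC Cx Cz Cy sC]] := exists_collinear_segment cT cvxT xzy.
have gP (s : R) : exists u, C u /\ mdist x u = clamp (mdist x y) s.
  by have [|u Cu us] := sC (clamp (mdist x y) s);
    [apply: clampP; exact: ltW|exists u].
pose g s := projT1 (cid (gP s)).
have gE s : C (g s) /\ mdist x (g s) = clamp (mdist x y) s
  by exact: (projT2 (cid (gP s))).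
have eqC u v : C u -> C v -> mdist x u = mdist x v -> u = v.
  move=> Cu Cv E; apply: mdist_positivity; apply/eqP; rewrite eq_le mdist_ge0.
  by have := linC _ _ Cu Cv; rewrite E subrr normr0 => ->.
have gu u : C u -> 0 <= mdist x u <= mdist x y -> g (mdist x u) = u.
  by move=> Cu uI; apply: eqC => //; rewrite ?(gE _).2 ?clamp_id//; exact: (gE _).1.
have cg : continuous g.
  apply: continuous_1lipschitz => s t; have [Cs gs] := gE s; have [Ct gt] := gE t.
  apply: le_trans (linC _ _ Cs Ct) _; rewrite gs gt.
  by apply: clamp_1lipschitz; exact: ltW.
have clD s : 0 <= s <= 1 -> clamp (mdist x y) (0 + mdist x y * s) = mdist x y * s.
  by move=> /andP[s0 s1]; rewrite add0r clamp_id//; apply/andP; split; nra.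
exists (fun s => g (0 + mdist x y * s)); split.
- split.
  - exact: continuous_affine.
  - move=> s t; rewrite !in_itv/= => sI tI /(congr1 (mdist x)).
    by rewrite !(gE _).2 !clD//; apply: mulfI; rewrite gt_eqF.
  - by rewrite mulr0 addr0 -(mdistxx x) gu// mdistxx; lra.
  - by rewrite mulr1 add0r gu//; lra.
- move=> s; rewrite in_itv/= => sI; have [Cs gs] := gE (0 + mdist x y * s).
  have h : mdist x (g (0 + mdist x y * s)) <= mdist x y.
    by rewrite gs clD//; case/andP: sI => ? ?; nra.
  by rewrite /between (collinear_from_le linC Cs Cy h); lra.
- by move=> _ _ [s _ <-] [t _ <-]; apply: linC; exact: (gE _).1.
rewrite /between in xzy.
exists (mdist x z / mdist x y); last first.
  by rewrite add0r mulrC divfK ?gt_eqF// gu//; lra.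
by rewrite in_itv/= divr_ge0 ?(ltW D0)//= ler_pdivrMr// mul1r; lra.
Qed.

(** This turns topology into metric information: a geodesic from [x] to [y] is an arc, so
    [arc_through] puts [c] on it. *)
Lemma between_arcs (R : realType) (T : metricType R) (c x y : T)
    (a b : R -> T) :
  compact [set: T] -> metrically_convex T -> ~ has_simple_loop R T ->
  arc c x a -> arc c y b ->
  (forall s t, s \in `[0, 1] -> t \in `[0, 1] -> a s = b t -> s = 0) ->
  between x c y.
Proof.
move=> cT cvxT noloop arca arcb ab.
have I1 : (1 : R) \in `[0, 1] by rewrite in_itv/=; lra.
have xy : x <> y.
  case: arca arcb => _ _ _ <- [_ _ _ <-] /(ab _ _ I1 I1) /eqP.
  by rewrite oner_eq0.
have [|e [arce ebetw _ _]] := @exists_geodesic_through _ _ x x y cT cvxT _ xy.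
  by rewrite /between mdistxx add0r.
have [s sI <-] := arc_through (@metric_hausdorff _ _) noloop arca arcb arce ab.
exact: ebetw.
Qed.

(** * Tree-like metric spaces *)

Definition tree_like (R : realType) (T : metricType R) :=
  [/\ compact [set: T], metrically_convex T & ~ has_simple_loop R T].

(** The median is the last point of a geodesic from [x] to [y] that lies on a geodesic from [x] to
    [z]. The remaining pieces meet only there, so [between_arcs] applies to them. *)
Lemma exists_median (R : realType) (T : metricType R) (x y z : T) :
  tree_like T -> exists m, [/\ between x m y, between x m z & between y m z].
Proof.
move=> [cT cvxT noloop].
have btl (u v : T) : between u u v by rewrite /between mdistxx add0r.
have btr (u v : T) : between u v v by rewrite /between mdistxx addr0.
have [<-|/eqP xy] := eqVneq x y; first by exists x.
have [<-|/eqP xz] := eqVneq x z.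
  by exists x; split => //; exact: btr.
have [e [[ce ie e0 e1] eb _ _]] := exists_geodesic_through cT cvxT (btl x y) xy.
have [f [[cf jf f0 f1] fb _ _]] := exists_geodesic_through cT cvxT (btl x z) xz.
have I0 : (0 : R) \in `[0, 1] by rewrite in_itv/=; lra.
have [||s0 [s0I [t0 t0I fe]] s0max] :=
    @exists_last R (`[0, 1] `&` e @^-1` (f @` `[0, 1])).
- by exists 0; split => //=; exists 0 => //; rewrite e0 f0.
- apply: compact_closedI; first exact: segment_compact.
  apply: closed_comp; first by move=> s _; exact: ce.
  apply: compact_closed; first exact: metric_hausdorff.
  apply: continuous_compact; last exact: segment_compact.
  exact: continuous_subspaceT.
exists (e s0); split; [exact: eb|by rewrite -fe; exact: fb|].
move: s0I t0I; rewrite /= !in_itv/= => s0I t0I.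
(* If a remaining piece is a single point, the median is [y] or [z] and there is no arc to take. *)
have [s01|s01] := eqVneq s0 1; first by rewrite s01 e1.
have [t01|t01] := eqVneq t0 1; first by rewrite -fe t01 f1.
have {}s01 : s0 < 1 by rewrite lt_neqAle s01; lra.
have {}t01 : t0 < 1 by rewrite lt_neqAle t01; lra.
have sub (h : R -> T) r w : continuous h -> {in `[0, 1] &, injective h} ->
    h 1 = w -> 0 <= r < 1 -> arc (h r) w (fun s => h (r + (1 - r) * s)).
  move=> ch ih h1 rI; split.
  - exact: continuous_affine.
  - move=> s t; rewrite !in_itv/= => /andP[? ?] /andP[? ?] /ih.
    rewrite !in_itv/= => E; have {}E := E ltac:(nra) ltac:(nra).
    have r1 : 1 - r != 0 by rewrite gt_eqF //; lra.
    exact: (mulfI r1 (addrI _ E)).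
  - by rewrite mulr0 addr0.
  - by rewrite mulr1 addrC subrK.
apply: (between_arcs cT cvxT noloop (sub e s0 y ce ie e1 _) _
  (b := fun s => f (t0 + (1 - t0) * s))).
- by lra.
- by rewrite -fe; apply: sub => //; lra.
move=> s t; rewrite !in_itv/= => /andP[? ?] /andP[? ?] E.
have : s0 + (1 - s0) * s <= s0.
  apply: s0max; split => /=; first by rewrite in_itv/=; nra.
  by exists (t0 + (1 - t0) * t) => //; rewrite /= in_itv/=; nra.
by move=> ?; nra.
Qed.

(** A geodesic from [x] to [y] through [n] must also pass through [m], because geodesics from [m] to
    [x] and to [y] meet only at [m]. *)
Lemma between_collinear (R : realType) (T : metricType R) (x y m n : T) :
  tree_like T -> between x m y -> between x n y ->
  mdist m n <= `|mdist x m - mdist x n|.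
Proof.
move=> [cT cvxT noloop] xmy xny.
have btl (u v : T) : between u u v by rewrite /between mdistxx add0r.
have [->|/eqP mx] := eqVneq m x.
  by rewrite mdistxx sub0r normrN ger0_norm// mdist_ge0.
have [->|/eqP my] := eqVneq m y.
  rewrite metric_sym; apply: le_trans (ler_norm _).
  by rewrite /between in xny; lra.
have [xy|/eqP xy] := eqVneq x y.
  exfalso; apply: mx; apply: mdist_positivity; move: xmy.
  rewrite /between -xy mdistxx (metric_sym x m).
  by have := mdist_ge0 m x; lra.
have [e [arce _ line [sn snI esn]]] := exists_geodesic_through cT cvxT xny xy.
have [a [arca ab _ _]] := exists_geodesic_through cT cvxT (btl m x) mx.
have [b [arcb bb _ _]] := exists_geodesic_through cT cvxT (btl m y) my.
have I0 : (0 : R) \in `[0, 1] by rewrite in_itv/=; lra.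
have [|s sI esm] := arc_through (@metric_hausdorff _ _) noloop arca arcb arce.
  move=> s t sI tI E; case: arca => _ ia a0 _.
  apply: ia => //; rewrite a0; apply/esym/mdist_positivity.
  have := ab _ sI; have := bb _ tI; have := metric_triangle x (a s) y.
  have := mdist_ge0 m (a s).
  rewrite /between -E (metric_sym x (a s)) (metric_sym m x) in xmy *.
  by lra.
by rewrite -esm -esn; apply: line; eexists.
Qed.

(** The negation of [between x p y]. In a tree it says that [x] and [y] lie in one component of the
    complement of [p]. *)
Definition same_side (R : realType) (T : metricType R) (p x y : T) :=
  mdist x y < mdist x p + mdist p y.

Lemma same_sideC (R : realType) (T : metricType R) (p x y : T) :
  same_side p x y -> same_side p y x.
Proof.
by rewrite /same_side (metric_sym x y) (metric_sym y p) (metric_sym p x) addrC.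
Qed.

Lemma not_same_side (R : realType) (T : metricType R) (p x y : T) :
  ~ same_side p x y -> between x p y.
Proof.
move=> /negP; rewrite -leNgt /between => h.
by have := metric_triangle x p y; lra.
Qed.

Lemma between_not_same_side (R : realType) (T : metricType R) (p x y : T) :
  between x p y -> ~ same_side p x y.
Proof. by rewrite /between /same_side => ->; rewrite ltxx. Qed.

(** The medians [m] of [p, x, y] and [n] of [p, y, z] differ from [p] and lie on one geodesic from
    [p] to [y]. Going from [x] to [z] through [m] and [n] saves twice the smaller of their distances
    to [p]. *)
Lemma same_side_trans (R : realType) (T : metricType R) (p x y z : T) :
  tree_like T -> same_side p x y -> same_side p y z -> same_side p x z.
Proof.
move=> treeT xy yz.
have [m [pmx pmy xmy]] := exists_median p x y treeT.
have [n [pny pnz ynz]] := exists_median p y z treeT.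
have mn := between_collinear treeT pmy pny.
have m0 : 0 < mdist p m.
  rewrite mdist_gt0; apply/eqP => pm.
  by apply: between_not_same_side xy; rewrite pm.
have n0 : 0 < mdist p n.
  rewrite mdist_gt0; apply/eqP => pn.
  by apply: between_not_same_side yz; rewrite pn.
have := metric_triangle x m z; have := metric_triangle m n z.
rewrite /between /same_side in xy yz pmx pmy pny pnz *.
rewrite (metric_sym x m) (metric_sym x p).
by move: mn; have [h|h] := ger0P (mdist p m - mdist p n); lra.
Qed.

(* A point as far as possible behind [a] cannot be passed any further. *)
Lemma exists_end_behind (R : realType) (T : metricType R) (isend : set T)
    (a : T) (S : set T) :
  tree_like T ->
  (forall w, ~ isend w -> exists w1 w2,
    [/\ w1 <> w, w2 <> w & between w1 w w2]) ->
  (forall x y, S x -> S y -> same_side a x y) ->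
  exists2 w, isend w & forall x, S x -> between w a x.
Proof.
move=> treeT ext Sside; have [cT _ _] := treeT.
pose W := [set w | forall x, S x -> between w a x].
have clW : closed W.
  have -> : W = \bigcap_(x in S)
      ((fun w => mdist x w - mdist a w) @^-1` [set mdist a x]).
    apply/seteqP; split => w h x Sx; have := h x Sx;
      by rewrite /between/= (metric_sym w x) (metric_sym w a); lra.
  apply: closed_bigI => x _; apply: closed_comp; last exact: closed_eq.
  by move=> w _; apply: continuousB; exact: continuous_mdist.
have [|||w] := @compact_EVT_max T R (mdist a) W.
- by exists a => x Sx; rewrite /between mdistxx add0r.
- exact: subclosed_compact cT _.
- by apply: continuous_subspaceT; exact: continuous_mdist.
rewrite inE => Ww wmax.
exists w => //; apply: contrapT => /ext [w1 [w2 [w1w w2w w12]]].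
suff [v [vw Wv avw]] : exists v, [/\ v <> w, W v & between a w v].
  have := wmax v; rewrite inE => /(_ Wv); rewrite avw.
  have : 0 < mdist w v by rewrite mdist_gt0; apply/eqP => E; exact: vw.
  by move=> ?; lra.
(* At [w = a], if neither [w1] nor [w2] were in [W], both would be on the side of [S], hence on the
   same side of [a]. *)
have [aw|/eqP aw] := eqVneq w a.
  rewrite aw in w1w w2w w12 *.
  have bt v : between a a v by rewrite /between mdistxx add0r.
  have [W1|/existsNP[x /not_implyP[Sx nx]]] := pselect (W w1); first by exists w1.
  have [W2|/existsNP[y /not_implyP[Sy ny]]] := pselect (W w2); first by exists w2.
  exfalso; apply: (between_not_same_side w12).
  have sx : same_side a w1 x by apply: contrapT => /not_same_side.
  have sy : same_side a w2 y by apply: contrapT => /not_same_side.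
  apply: (same_side_trans treeT sx).
  by apply: same_side_trans treeT (Sside _ _ Sx Sy) _; exact: same_sideC.
(* A point beyond [w] as seen from [a] is also beyond [w] as seen from [S], since [a] and [S] are on
   the same side of [w]. *)
have key v : v <> w -> between v w a ->
    exists v, [/\ v <> w, W v & between a w v].
  move=> vw vwa; exists v; split => //; last exact: betweenC.
  move=> x Sx; have wax := Ww x Sx.
  have awx : same_side w a x.
    have : 0 < mdist a w by rewrite mdist_gt0; apply/eqP => E; exact: aw.
    by rewrite /same_side wax (metric_sym a w); lra.
  suff vwx : between v w x.
    by rewrite /between vwx vwa wax; lra.
  apply: not_same_side => vx; apply: (between_not_same_side vwa).
  by apply: same_side_trans treeT vx _; exact: same_sideC.
have [b1|/(contra_not (@not_same_side _ _ _ _ _))/contrapT s1] :=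
  pselect (between w1 w a); first exact: key b1.
have [b2|/(contra_not (@not_same_side _ _ _ _ _))/contrapT s2] :=
  pselect (between w2 w a); first exact: key b2.
exfalso; apply: (between_not_same_side w12).
by apply: same_side_trans treeT s1 _; exact: same_sideC.
Qed.

(** * Metric graphs *)

Lemma mdist_le_chain (R : realType) (T : metricType R)
    (G : finite_metric_graph T) x y l :
  chain (len G) (chart G) x y l -> mdist x y <= l.
Proof.
move=> xyl; rewrite -lee_fin (graph_mdistE G).
by apply: ereal_inf_lbound; exists l.
Qed.

Lemma exists_short_chain (R : realType) (T : metricType R)
    (G : finite_metric_graph T) (x y : T) e :
  0 < e -> exists2 l, chain (len G) (chart G) x y l & l < mdist x y + e.
Proof.
move=> e0.
have /ereal_inf_lt [_ [l xyl <-]] :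
    (ereal_inf [set l%:E | l in chain (len G) (chart G) x y] <
     (mdist x y + e)%:E)%E.
  by rewrite -graph_mdistE lte_fin ltrDl.
by rewrite lte_fin; exists l.
Qed.

Lemma mdist_chart (R : realType) (T : metricType R)
    (G : finite_metric_graph T) (e : edge G) s t :
  0 <= s <= len G e -> 0 <= t <= len G e ->
  mdist (chart G e s) (chart G e t) <= `|s - t|.
Proof.
move=> sI tI; rewrite -[leRHS]addr0; apply: (@mdist_le_chain _ _ G).
by apply: chain_move => //; exact: chain_nil.
Qed.

Lemma continuous_chart (R : realType) (T : metricType R)
    (G : finite_metric_graph T) (e : edge G) :
  continuous (fun t => chart G e (clamp (len G e) t)).
Proof.
have l0 := ltW (len_gt0 e).
apply: continuous_1lipschitz => s t.
apply: le_trans (clamp_1lipschitz s t l0).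
by apply: mdist_chart; exact: clampP.
Qed.

Lemma compact_graph (R : realType) (T : metricType R)
    (G : finite_metric_graph T) : compact [set: T].
Proof.
pose F e := (fun t => chart G e (clamp (len G e) t)) @` `[0, len G e].
have -> : [set: T] = vertices G `|` \big[setU/set0]_(e <- enum (edge G)) F e.
  apply/seteqP; split => // x _; have [?|[e [t tI <-]]] := chart_cover G x.
    by left.
  right; rewrite -bigcup_seq; exists e; first by rewrite /= mem_enum.
  by exists t; rewrite /= ?in_itv//= clamp_id.
apply: compactU; first exact/finite_compact/finite_vertices.
apply: bigsetU_compact => e _; apply: continuous_compact.
  exact/continuous_subspaceT/continuous_chart.
exact: segment_compact.
Qed.

(** The chain is cut where the travelled length reaches [s]; the cut falls within one move, whose
    segment supplies the point. *)
Lemma chain_split (R : realType) (T : metricType R)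
    (G : finite_metric_graph T) x y l s :
  chain (len G) (chart G) x y l -> 0 <= s <= l ->
  exists z, mdist x z <= s /\ mdist z y <= l - s.
Proof.
move=> xyl; elim: xyl s => {x y l} [x s sI|e a t y l aI tI tyl IH s sI].
  by exists x; rewrite mdistxx; lra.
have dty := mdist_le_chain tyl.
have [sat|sat] := leP s `|a - t|.
  have [u [uI au ut]] : exists u,
      [/\ 0 <= u <= len G e, `|a - u| = s & `|u - t| = `|a - t| - s].
    move: sat; have [h|h] := ger0P (a - t) => sat.
      exists (a - s); split; first lra.
        by rewrite subKr ger0_norm//; lra.
      by rewrite ger0_norm; lra.
    exists (a + s); split; first lra.
      by rewrite opprD addrA subrr sub0r normrN ger0_norm//; lra.
    by rewrite ler0_norm; lra.
  exists (chart G e u); have := mdist_chart aI uI; have := mdist_chart uI tI.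
  by have := metric_triangle (chart G e u) (chart G e t) y; rewrite au ut; lra.
have [|z [tz zy]] := IH (s - `|a - t|); first by lra.
exists z; have := mdist_chart aI tI.
by have := metric_triangle (chart G e a) (chart G e t) z; lra.
Qed.

(** Since the distance is only an infimum over chains, the point is taken nearest to [y] in the
    compact ball of radius [s] about [x]. Cutting ever shorter chains at [s] bounds its distance to
    [y]. *)
Lemma metrically_convex_graph (R : realType) (T : metricType R)
    (G : finite_metric_graph T) : metrically_convex T.
Proof.
move=> x y s sI.
have clK : closed [set z | mdist x z <= s].
  have -> : [set z | mdist x z <= s] = mdist x @^-1` [set t | t <= s] by [].
  by apply: closed_comp; [move=> u _; exact: continuous_mdist|exact: closed_le].
have [|||z] := @compact_EVT_min T R (mdist y) [set z | mdist x z <= s].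
- by exists x; rewrite /= mdistxx; lra.
- exact: subclosed_compact (compact_graph G) _.
- exact/continuous_subspaceT/continuous_mdist.
rewrite inE /= => xz zmin.
have zy : mdist y z <= mdist x y - s.
  apply/ler_addgt0Pr => e e0; have [l xyl le] := exists_short_chain G x y e0.
  have [|z' [xz' z'y]] := chain_split xyl (s := s).
    by have := mdist_le_chain xyl; lra.
  have := zmin z'; rewrite inE (metric_sym y z') => /(_ xz'); lra.
exists z; have := metric_triangle x z y; rewrite (metric_sym z y).
by split; lra.
Qed.

Lemma chart_end_or_inside (R : realType) (T : metricType R)
    (G : finite_metric_graph T) (e : edge G) t : 0 <= t <= len G e ->
  (exists2 b : bool, t = (if b then len G e else 0) &
    vertices G (chart G e t)) \/
  0 < t < len G e /\ ~ vertices G (chart G e t).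
Proof.
move=> tI; have [->|t0] := eqVneq t 0.
  by left; exists false => //; exact: chart_src.
have [->|tl] := eqVneq t (len G e).
  by left; exists true => //; exact: chart_tgt.
have tI' : 0 < t < len G e by rewrite !lt_neqAle tl eq_sym t0 tI.
by right; split => //; exact: chart_notin_vertices.
Qed.

Lemma chart_inside_inj (R : realType) (T : metricType R)
    (G : finite_metric_graph T) (e e' : edge G) t t' :
  0 <= t <= len G e -> 0 < t' < len G e' -> chart G e t = chart G e' t' ->
  e = e' /\ t = t'.
Proof.
move=> tI tI' E; have [[b _]|[t_in _]] := chart_end_or_inside tI.
  by rewrite E => /(chart_notin_vertices tI').
exact: chart_inj t_in tI' E.
Qed.

(** The start may be a vertex, but the rest of the arc, its end included, stays inside the edge.
    This gives injectivity even on a loop edge; [v] is negative when the edge is run backwards. *)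
Lemma chart_arc (R : realType) (T : metricType R)
    (G : finite_metric_graph T) (e : edge G) t v :
  0 <= t <= len G e -> v != 0 ->
  (forall s, 0 < s <= 1 -> 0 < t + v * s < len G e) ->
  arc (chart G e t) (chart G e (t + v))
    (fun s => chart G e (clamp (len G e) (t + v * s))).
Proof.
move=> tI v0 tvI.
have rng s : 0 <= s <= 1 -> 0 <= t + v * s <= len G e.
  move=> sI; have [->|s0] := eqVneq s 0; first by rewrite mulr0 addr0.
  have := tvI s; rewrite lt_neqAle eq_sym s0 sI => /(_ isT).
  by lra.
have inj s s' : 0 <= s <= 1 -> 0 < s' <= 1 ->
    chart G e (clamp (len G e) (t + v * s)) =
    chart G e (clamp (len G e) (t + v * s')) -> s = s'.
  move=> sI s'I; have h := rng s sI; have h' := tvI s' s'I.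
  rewrite !clamp_id//; last lra.
  by move=> /(chart_inside_inj h h')[_ /addrI]; exact: mulfI.
split.
- exact: (@continuous_affine _ _ (fun s => chart G e (clamp (len G e) s)) t v
    (continuous_chart (e := e))).
- move=> s s'; rewrite !in_itv/= => sI s'I E.
  have [s'0|s'0] := eqVneq s' 0; last first.
    by apply: inj E => //; rewrite lt_neqAle eq_sym s'0.
  have [s0|s0] := eqVneq s 0; first by rewrite s0 s'0.
  by apply/esym/(inj s' s) => //; rewrite lt_neqAle eq_sym s0.
- by rewrite mulr0 addr0 clamp_id.
- rewrite mulr1 clamp_id//.
  by have := tvI 1; rewrite mulr1 => /(_ ltac:(lra)); lra.
Qed.

Lemma tree_like_graph (R : realType) (T : metricType R)
    (G : finite_metric_graph T) : is_metric_tree G -> tree_like T.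
Proof.
by split => //; [exact: compact_graph G|exact: metrically_convex_graph G].
Qed.

(** Two arcs leaving a point along disjoint pieces of edges share only their start, so that point is
    between their ends. *)
Lemma between_charts (R : realType) (T : metricType R)
    (G : finite_metric_graph T) (e e' : edge G) t t' v v' :
  tree_like T -> chart G e t = chart G e' t' ->
  0 <= t <= len G e -> 0 <= t' <= len G e' -> v != 0 -> v' != 0 ->
  (forall s, 0 < s <= 1 -> 0 < t + v * s < len G e) ->
  (forall s, 0 < s <= 1 -> 0 < t' + v' * s < len G e') ->
  (forall s s', 0 < s <= 1 -> 0 < s' <= 1 -> e = e' ->
    t + v * s <> t' + v' * s') ->
  exists w1 w2, [/\ w1 <> chart G e t, w2 <> chart G e t &
    between w1 (chart G e t) w2].
Proof.
move=> [cT cvxT noloop] E tI t'I v0 v'0 tvI t'v'I disj.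
have arca := chart_arc tI v0 tvI; have arcb := chart_arc t'I v'0 t'v'I.
rewrite -E in arcb.
have I0 : (0 : R) \in `[0, 1] by rewrite in_itv/=; lra.
have I1 : (1 : R) \in `[0, 1] by rewrite in_itv/=; lra.
have end_neq x y (a : R -> T) : arc x y a -> y <> x.
  by move=> [_ ia <- <-] /(ia _ _ I1 I0) /eqP; rewrite oner_eq0.
exists (chart G e (t + v)), (chart G e' (t' + v')); split.
- exact: end_neq arca.
- exact: end_neq arcb.
apply: (between_arcs cT cvxT noloop arca arcb) => s s' sI s'I.
have [->//|s0] := eqVneq s 0.
have [->|s'0] := eqVneq s' 0.
  by case: arca arcb => _ ia <- _ [_ _ -> _]; apply: ia.
move: sI s'I; rewrite !in_itv/= => sI s'I.
have sP : 0 < s <= 1 by rewrite lt_neqAle eq_sym s0.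
have s'P : 0 < s' <= 1 by rewrite lt_neqAle eq_sym s'0.
have h := tvI _ sP; have h' := t'v'I _ s'P.
rewrite !clamp_id//; [|lra|lra].
by move=> /(chart_inj h h')[] /(disj _ _ sP s'P).
Qed.

Lemma chain_start (R : realType) (T E : Type) (len : E -> R)
    (chart : E -> R -> T) x y l : chain len chart x y l ->
  x = y \/ exists e, exists2 s, 0 <= s <= len e & chart e s = x.
Proof. by case=> [|e s t]; [left|right; exists e, s]. Qed.

(** Two directions leave [w]: both ways along an edge if [w] is not a vertex, and two edge ends
    otherwise. The point [u] rules out an isolated vertex. *)
Lemma extend_at_nonleaf (R : realType) (T : metricType R)
    (G : finite_metric_graph T) (u w : T) :
  is_metric_tree G -> u <> w -> ~ leaves G w ->
  exists w1 w2, [/\ w1 <> w, w2 <> w & between w1 w w2].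
Proof.
move=> treeG uw nleaf; have treeT := tree_like_graph treeG.
have [Vw|nVw] := pselect (vertices G w); last first.
  have [//|[e [t tI tw]]] := chart_cover G w.
  have [[b _]|[t_in _]] := chart_end_or_inside tI; first by rewrite tw.
  rewrite -tw.
  apply: (@between_charts _ _ G e e t t (- (t / 2)) ((len G e - t) / 2)) => //.
  - by rewrite oppr_eq0 gt_eqF //; lra.
  - by rewrite gt_eqF //; lra.
  - by move=> s /andP[? ?]; apply/andP; split; nra.
  - by move=> s /andP[? ?]; apply/andP; split; nra.
  - move=> s s' /andP[? ?] /andP[? ?] _ E.
    have : - (t / 2) * s < 0 by nra.
    have : 0 < (len G e - t) / 2 * s' by nra.
    by move=> ? ?; suff : t < t by [rewrite ltxx]; lra.
have [deg1|deg1] := eqVneq (degree G w) 1%N; first by case: nleaf.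
have [deg0|deg0] := posnP (degree G w).
  (* A chain from [w] to [u <> w] begins on an edge, and a vertex on an edge is one of its ends. *)
  exfalso; have [l wul _] := exists_short_chain G w u ltr01.
  have [/esym//|[e [t tI tw]]] := chain_start wul.
  have [[b tb _]|[_]] := chart_end_or_inside tI; last by rewrite tw.
  have := card0_eq deg0 (e, b); rewrite !inE => /negP; apply.
  by apply/asboolP; rewrite /edge_end/= -tb.
have /card_gt1P [[e b] [[e' b']]] : (1 < degree G w)%N.
  by rewrite ltn_neqAle eq_sym deg1.
rewrite !inE /= /edge_end => -[eb eb' neq].
have l0 := len_gt0 e; have l0' := len_gt0 e'.
rewrite -eb.
(* Going a third of the way keeps the two pieces disjoint when they are the two ends of one edge. *)
pose v (c : bool) (r : R) := if c then - (r / 3) else r / 3.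
apply: (@between_charts _ _ G e e' _ (if b' then len G e' else 0)
  (v b (len G e)) (v b' (len G e'))) => //.
- by rewrite eb eb'.
- by case: (b); apply/andP; split; lra.
- by case: (b'); apply/andP; split; lra.
- by rewrite /v; case: (b); rewrite ?oppr_eq0 gt_eqF //; lra.
- by rewrite /v; case: (b'); rewrite ?oppr_eq0 gt_eqF //; lra.
- by rewrite /v => s /andP[? ?]; case: (b); apply/andP; split; nra.
- by rewrite /v => s /andP[? ?]; case: (b'); apply/andP; split; nra.
move=> s s' /andP[s0 s1] /andP[s0' s1'] ee' E; subst e'.
suff : len G e < len G e by rewrite ltxx.
have hs : len G e * s <= len G e by nra.
have hs' : len G e * s' <= len G e by nra.
by move: neq E; rewrite xpair_eqE eqxx /v; case: (b); case: (b') => //= _ E; lra.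
Qed.

(** * Leaf edges and distances between leaves *)

Lemma leaf_edge_uniq (R : realType) (T : metricType R)
    (G : finite_metric_graph T) (v : T) (p p' : edge G * bool) :
  leaves G v -> edge_end G p.1 p.2 = v -> edge_end G p'.1 p'.2 = v -> p = p'.
Proof.
move=> [_ deg1] pv p'v.
have /card_le1_eqP : (degree G v <= 1)%N by rewrite deg1.
by apply; rewrite inE.
Qed.

(** Here [ch s] is the point at parameter distance [s] from the leaf. A chain can leave the leaf
    edge only at its other end, and until then one move lowers the left-hand side by at most its own
    length. *)
Lemma chain_from_leaf_edge (R : realType) (T : metricType R)
    (G : finite_metric_graph T) (e : edge G) (b : bool) (u x y : T) l s :
  let ch s := chart G e (if b then len G e - s else s) in
  leaves G (edge_end G e b) -> vertices G u -> u <> edge_end G e b ->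
  chain (len G) (chart G) x y l -> y = u -> 0 <= s <= len G e -> x = ch s ->
  len G e - s + mdist (edge_end G e (~~ b)) u <= l.
Proof.
move=> ch leaf_e Vu uv xyl.
have l0 := len_gt0 e.
have chl : ch (len G e) = edge_end G e (~~ b).
  by rewrite /ch /edge_end; case: (b) => //=; rewrite subrr.
have ch0 : ch 0 = edge_end G e b.
  by rewrite /ch /edge_end; case: (b) => //=; rewrite subr0.
have ch_in r : 0 < r < len G e -> ~ vertices G (ch r).
  by move=> rI; apply: chart_notin_vertices; case: (b); lra.
elim: xyl s => {x y l} [x s xu sI xs|e' a t y l aI tI tyl IH s yu sI as_].
  have [s0|s0] := eqVneq s 0; first by case: uv; rewrite -ch0 -s0 -xs.
  have [sl|sl] := eqVneq s (len G e).
    by rewrite -xu xs sl chl mdistxx; lra.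
  by case: (ch_in s); rewrite -?xs ?xu// !lt_neqAle sl eq_sym s0.
have [sl|sl] := eqVneq s (len G e).
  rewrite sl -chl -sl -as_ subrr add0r -yu.
  by apply: (@mdist_le_chain _ _ G); exact: chain_move.
(* Before the far end the next move stays on [e]: an interior point lies on no other edge, and a
   leaf is the end of one edge only. *)
have [ee' aE] : e' = e /\ a = (if b then len G e - s else s).
  have [s0|s0] := eqVneq s 0; last first.
    apply: (@chart_inside_inj _ _ G) as_ => //.
    have : 0 < s < len G e by rewrite !lt_neqAle sl eq_sym s0.
    by case: (b); lra.
  have [[c ac _]|[_]] := chart_end_or_inside aI; last first.
    by rewrite as_ s0 ch0; case: leaf_e.
  have E : edge_end G e' c = edge_end G e b.
    by rewrite {1}/edge_end -ac as_ s0 ch0.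
  have [ee' cb] := @leaf_edge_uniq _ _ G _ (e', c) (e, b) leaf_e E erefl.
  by split => //; rewrite ac ee' cb s0; case: (b); rewrite ?subr0.
subst e'; have := IH (if b then len G e - t else t) yu.
rewrite /ch aE; case: (b) => /=.
  rewrite subKr => /(_ ltac:(lra) erefl).
  by have := ler_norm (len G e - s - t); lra.
by move=> /(_ tI erefl); rewrite distrC; have := ler_norm (t - s); lra.
Qed.

Lemma mdist_leaf_vertex (R : realType) (T : metricType R)
    (G : finite_metric_graph T) (e : edge G) (b : bool) (u : T) :
  leaves G (edge_end G e b) -> vertices G u -> u <> edge_end G e b ->
  len G e + mdist (edge_end G e (~~ b)) u <= mdist (edge_end G e b) u.
Proof.
move=> leaf_e Vu uv; apply/ler_addgt0Pr => d d0.
have l0 := len_gt0 e.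
have [l vul lt] := exists_short_chain G (edge_end G e b) u d0.
have := chain_from_leaf_edge (s := 0) leaf_e Vu uv vul erefl.
by rewrite /edge_end subr0 => /(_ ltac:(lra) erefl); rewrite /edge_end in lt *; lra.
Qed.

Lemma leaf_edgeP (R : realType) (T : metricType R)
    (G : finite_metric_graph T) (v : T) :
  leaves G v -> exists e b, v = edge_end G e b.
Proof.
move=> [_ deg1]; have : (0 < degree G v)%N by rewrite deg1.
by move=> /card_gt0P [[e b]]; rewrite inE /= => <-; exists e, b.
Qed.

(** Both distances from [v] contain the whole leaf edge at [v]; the rest is bounded by the triangle
    inequality at its other end. The case [u = w] bounds the distance of two leaves from below. *)
Lemma leaf_gromov_product (R : realType) (T : metricType R)
    (G : finite_metric_graph T) (r : R) (v u w : T) :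
  (forall e, leaf_edges G e -> r <= len G e) ->
  leaves G v -> leaves G u -> leaves G w -> u <> v -> w <> v ->
  mdist u w + 2 * r <= mdist v u + mdist v w.
Proof.
move=> rmin leaf_v [Vu _] [Vw _] uv wv.
have [e [b ve]] := leaf_edgeP leaf_v.
have re : r <= len G e by apply: rmin; exists b; rewrite -ve.
rewrite ve in leaf_v uv wv *.
have := mdist_leaf_vertex leaf_v Vu uv; have := mdist_leaf_vertex leaf_v Vw wv.
have := metric_triangle u (edge_end G e (~~ b)) w.
by rewrite (metric_sym u (edge_end G e (~~ b))); lra.
Qed.

(** * Coarse isometries of metric trees *)

(** By injectivity any repetition in the orbit can be pulled back to [a], and an orbit without
    repetition does not fit in a finite set. *)
Lemma periodic_of_injective (T : eqType) (A : set T) (f : T -> T) (a : T) :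
  finite_set A -> (forall x, A x -> A (f x)) ->
  (forall x y, A x -> A y -> f x = f y -> x = y) -> A a ->
  exists n, iter n.+1 f a = a.
Proof.
move=> /finite_seqP[s AE] fA inj_f Aa.
have itA n : A (iter n f a) by elim: n => //= n; exact: fA.
apply: contrapT => noper.
have neq i k : iter (i + k.+1) f a <> iter i f a.
  elim: i => [|i IH]; first by move=> E; apply: noper; exists k.
  by rewrite addSn !iterS => /inj_f E; apply: IH; apply: E.
have inj_it : injective (fun n => iter n f a).
  move=> i j /= E; have [ij|ji|//] := ltngtP i j.
  - by case: (neq i (j - i.+1)%N); rewrite -addSnnS subnKC.
  - by case: (neq j (i - j.+1)%N); rewrite -addSnnS subnKC.
have := @uniq_leq_size _ (map (fun n => iter n f a) (iota 0 (size s).+1)) s.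
rewrite map_inj_uniq // iota_uniq size_map size_iota ltnn => E.
suff : false by [].
apply: E => // _ /mapP[n _ ->]; have := itA n; rewrite AE /=.
by [].
Qed.

(* The points [t] with [F t] on a given side of [p] form a clopen set. *)
Lemma coarse_image_one_side (R : realType) (T : metricType R) (X : set T)
    (r : R) (F : T -> T) (p : T) :
  tree_like T -> connected [set: T] -> 0 < r -> (forall t, X (F t)) ->
  (forall s t, mdist (F s) (F t) < mdist s t + r) ->
  (forall x, X x -> exists t, mdist x (F t) < r) ->
  (forall x, X x -> r <= mdist p x) ->
  forall x y, X x -> X y -> same_side p x y.
Proof.
move=> treeT connT r0 XF Fr nearF pX.
(* The images are less than [2 * r] apart and each is at least [r] from [p], so [p] is not between
   them. *)
have same s t : mdist s t <= r -> same_side p (F s) (F t).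
  move=> st; rewrite /same_side (metric_sym (F s) p).
  by have := Fr s t; have := pX _ (XF s); have := pX _ (XF t); lra.
pose A := [set t | same_side p (F p) (F t)].
have stable s t : mdist s t <= r -> A s -> A t.
  by move=> st As; apply: (same_side_trans treeT As); exact: same.
have openA : open A.
  rewrite openE => s As; apply/metricType_numDomainType.nbhs_mdistP.
  by exists r => // t /= /ltW st; exact: stable As.
have openCA : open (~` A).
  rewrite openE => s As; apply/metricType_numDomainType.nbhs_mdistP.
  exists r => // t /= /ltW st At; apply: As.
  by apply: stable At; rewrite metric_sym.
have AT : A = [set: T].
  apply: connT.
  - by exists p; apply: same; rewrite mdistxx ltW.
  - by exists A => //; rewrite setTI.
  - by exists A; rewrite ?setTI//; rewrite -[A]setCK; exact: open_closedC.
have side x : X x -> same_side p (F p) x.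
  move=> Xx; have [t xt] := nearF x Xx.
  have At : A t by rewrite AT.
  apply: (same_side_trans treeT At).
  rewrite /same_side (metric_sym _ x) (metric_sym _ p).
  by have := pX _ Xx; have := pX _ (XF t); lra.
move=> x y Xx Xy; apply: (same_side_trans treeT _ (side y Xy)).
by apply: same_sideC; exact: side.
Qed.

(** The distinct points [p] and [q] provide, for every [w], a point other than [w], as
    [extend_at_nonleaf] requires. *)
Lemma exists_leaf_behind (R : realType) (T : metricType R)
    (G : finite_metric_graph T) (p q a : T) (S : set T) :
  is_metric_tree G -> p <> q ->
  (forall x y, S x -> S y -> same_side a x y) ->
  exists2 w, leaves G w & forall x, S x -> between w a x.
Proof.
move=> treeG pq; apply: exists_end_behind; first exact: tree_like_graph treeG.
move=> w; have [<-|/eqP pw] := eqVneq p w.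
  exact: (extend_at_nonleaf treeG (nesym pq)).
exact: (extend_at_nonleaf treeG pw).
Qed.

Lemma leaf_behind_coarse_isometry (R : realType) (T : metricType R)
    (G : finite_metric_graph T) (r : R) (F : T -> T) (p q : T) :
  is_metric_tree G -> p <> q ->
  (forall e, leaf_edges G e -> 2 * r <= len G e) ->
  (forall s t, `|mdist (F s) (F t) - mdist s t| < r) ->
  exists f : T -> T, forall v, leaves G v -> leaves G (f v) /\
    forall w, leaves G w -> w <> v -> between (f v) (F v) (F w).
Proof.
move=> treeG pq len_r Fr.
have leafP v : exists w, leaves G v -> leaves G w /\
    forall u, leaves G u -> u <> v -> between w (F v) (F u).
  have [leaf_v|nleaf] := pselect (leaves G v); last by exists v.
  have [|w leaf_w bw] := @exists_leaf_behind _ _ G p q (F v)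
      (F @` [set u | leaves G u /\ u <> v]) treeG pq.
    move=> _ _ [u [leaf_u uv] <-] [w [leaf_w wv] <-].
    (* The slack in this inequality is [4 * r], and the three distortions cost less than [3 * r]. *)
    have := leaf_gromov_product len_r leaf_v leaf_u leaf_w uv wv.
    have := Fr u w; have := Fr u v; have := Fr v w.
    by rewrite /same_side !ltr_norml (metric_sym u v); lra.
  by exists w => _; split => // u leaf_u uv; apply: bw; exists u.
by have [f fP] := choice leafP; exists f.
Qed.

(** Here [r] bounds the distortion; it will be twice the Hausdorff radius. *)
Lemma no_coarse_isometry_off_point (R : realType) (T : metricType R)
    (G : finite_metric_graph T) (X : set T) (r : R) (F : T -> T) (p : T) :
  is_metric_tree G -> 0 < r ->
  (forall e, leaf_edges G e -> 2 * r <= len G e) ->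
  (forall y y', leaf_dists G y -> leaf_dists G y' -> y <> y' ->
    r <= `|y - y'|) ->
  (forall t, X (F t)) ->
  (forall s t, `|mdist (F s) (F t) - mdist s t| < r) ->
  (forall x, X x -> exists t, mdist x (F t) < r) ->
  exists2 x, X x & mdist p x < r.
Proof.
move=> treeG r0 len_r sep_r XF Fr nearF; apply: contrapT => far.
have {far}pX x : X x -> r <= mdist p x.
  by move=> Xx; rewrite leNgt; apply/negP => px; apply: far; exists x.
have Fle s t : mdist s t - r < mdist (F s) (F t).
  by have := Fr s t; rewrite ltr_norml; lra.
have Fge s t : mdist (F s) (F t) < mdist s t + r.
  by have := Fr s t; rewrite ltr_norml; lra.
have treeT := tree_like_graph treeG.
have Xside := coarse_image_one_side treeT (graph_connected G) r0 XF Fge nearF pX.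
have pq : p <> F p.
  by move=> E; have := pX _ (XF p); rewrite -E mdistxx; lra.
have [v0 leaf_v0 v0X] := exists_leaf_behind treeG pq Xside.
(* A second leaf is found behind any [q <> v0] as seen from [v0]. *)
have [w0 leaf_w0 w0v0] : exists2 w, leaves G w & w <> v0.
  have [q qv0] : exists q, q <> v0.
    by have [<-|/eqP pv0] := eqVneq p v0; [exists (F p); exact: nesym|exists p].
  have qv0' : 0 < mdist q v0 by rewrite mdist_gt0; exact/eqP.
  have [|w leaf_w bw] := @exists_leaf_behind _ _ G p (F p) q [set v0] treeG pq.
    by move=> _ _ -> ->; rewrite /same_side mdistxx (metric_sym v0 q); lra.
  exists w => // wv0; have := bw v0 erefl.
  by rewrite /between wv0 mdistxx; have := mdist_ge0 v0 q; lra.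
have [f fP] := leaf_behind_coarse_isometry treeG pq len_r Fr.
have leaf_far v w : leaves G v -> leaves G w -> v <> w -> 2 * r <= mdist v w.
  move=> leaf_v leaf_w vw.
  have := leaf_gromov_product len_r leaf_v leaf_w leaf_w (nesym vw) (nesym vw).
  by rewrite mdistxx; lra.
have fdist v w : leaves G v -> leaves G w -> v <> w ->
    mdist (f v) (f w) = mdist (f v) (F v) + mdist (F v) (F w) + mdist (F w) (f w).
  move=> leaf_v leaf_w vw.
  have vFw := (fP v leaf_v).2 w leaf_w (nesym vw).
  have wFv := (fP w leaf_w).2 v leaf_v vw.
  have FvFw : 0 < mdist (F v) (F w).
    by have := Fle v w; have := leaf_far v w leaf_v leaf_w vw; lra.
  have side : same_side (F w) (f v) (F v).
    by rewrite /same_side vFw (metric_sym (F w)); lra.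
  (* Otherwise [f w] would be on the side of [f v], hence of [F v], with respect to [F w], although
     [F w] is between [f w] and [F v]. *)
  suff : between (f v) (F w) (f w) by rewrite /between vFw.
  apply: not_same_side => fvw; apply: (between_not_same_side wFv).
  by apply: (same_side_trans treeT (same_sideC fvw)).
have fgt v w : leaves G v -> leaves G w -> v <> w ->
    mdist v w - r < mdist (f v) (f w).
  move=> leaf_v leaf_w vw; rewrite fdist//.
  have := Fle v w; have := mdist_ge0 (f v) (F v).
  by have := mdist_ge0 (F w) (f w); lra.
have f_inj v w : leaves G v -> leaves G w -> v <> w -> f v <> f w.
  move=> leaf_v leaf_w vw E; have := fgt v w leaf_v leaf_w vw.
  by rewrite E mdistxx; have := leaf_far v w leaf_v leaf_w vw; lra.
(* Both numbers are leaf distances, so a loss smaller than [r] is no loss. *)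
have fge v w : leaves G v -> leaves G w -> v <> w ->
    mdist v w <= mdist (f v) (f w).
  move=> leaf_v leaf_w vw; rewrite leNgt; apply/negP => lt_f.
  have := sep_r (mdist v w) (mdist (f v) (f w)).
  rewrite gtr0_norm ?subr_gt0// => H.
  have := fgt v w leaf_v leaf_w vw.
  suff : r <= mdist v w - mdist (f v) (f w) by lra.
  apply: H.
  - by exists v, w.
  - exists (f v), (f w); split => //; [exact: (fP v _).1|exact: (fP w _).1|].
    exact: f_inj.
  - by move=> E; rewrite E ltxx in lt_f.
(* Iterating on pairs gives a common period for both leaves. *)
pose A : set (T * T) := [set x | [/\ leaves G x.1, leaves G x.2 & x.1 <> x.2]].
pose ff (x : T * T) := (f x.1, f x.2).
have ffA x : A x -> A (ff x).
  move=> [l1 l2 neq]; split; [exact: (fP _ l1).1|exact: (fP _ l2).1|].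
  exact: f_inj.
have [||||n] := @periodic_of_injective _ A ff (v0, w0).
- apply: sub_finite_set (finite_setX (finite_vertices G) (finite_vertices G)).
  by move=> x [[? _] [? _] _].
- exact: ffA.
- have inj v w : leaves G v -> leaves G w -> f v = f w -> v = w.
    by move=> lv lw E; apply: contrapT => vw; exact: f_inj E.
  move=> [v w] [v' w'] [/= lv lw _] [/= lv' lw' _] [E E'].
  by rewrite (inj v v')// (inj w w').
- by split => //; exact: nesym.
rewrite iterS; have itA m : A (iter m ff (v0, w0)).
  by elim: m => [|m IH]; [split => //; exact: nesym|exact: ffA].
have grow m : mdist v0 w0 <=
    mdist (iter m ff (v0, w0)).1 (iter m ff (v0, w0)).2.
  elim: m => //= m IH; apply: le_trans IH _.
  by have [l1 l2 neq] := itA m; exact: fge.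
(* The last pair [(v, w)] before the return has [f v = v0] and [f w = w0], and its distance is at
   least that of [v0] and [w0]. By [fdist] then [mdist v0 (F v) < r], yet the path from [v0] to
   [F v] passes through [p]. *)
have := grow n; have := itA n; move: (iter n ff (v0, w0)) => [v w].
rewrite /ff /= => -[/= lv lw vw] le [fv fw].
have := fdist v w lv lw vw; have := Fle v w; rewrite fv fw.
have := v0X _ (XF v); have := pX _ (XF v); have := mdist_ge0 (F w) w0.
by have := mdist_ge0 v0 p; rewrite /between; lra.
Qed.

(** * From Gromov-Hausdorff distance to coarse isometries *)

(** [F t] is a point of [A] whose image is within [r] of [f t] in [Z]; replacing both ends changes a
    distance by less than [2 * r]. *)
Lemma coarse_map_of_hausdorff (R : realType) (M N Z : metricType R) (A : set N)
    (f : M -> Z) (g : N -> Z) (r : R) :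
  isometric_on [set: M] f -> isometric_on A g ->
  f @` [set: M] `<=` \bigcup_(b in g @` A) ball b r ->
  exists F : M -> N, [/\ forall t, A (F t),
    forall t, mdist (g (F t)) (f t) < r &
    forall s t, `|mdist (F s) (F t) - mdist s t| < 2 * r].
Proof.
move=> isof isog fg.
have [|F FP] := @choice M N (fun t x => A x /\ mdist (g x) (f t) < r).
  move=> t; have [|_ [x Ax <-]] := fg (f t); first by exists t.
  by rewrite ballEmdist => xt; exists x.
exists F; split => [t|t|s t]; [exact: (FP t).1|exact: (FP t).2|].
have [As Fs] := FP s; have [At Ft] := FP t.
rewrite -(isog _ _ As At) -(isof s t I I) ltr_norml.
have := metric_triangle (g (F s)) (f s) (g (F t)).
have := metric_triangle (f s) (f t) (g (F t)).
have := metric_triangle (f s) (g (F s)) (f t).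
have := metric_triangle (g (F s)) (g (F t)) (f t).
rewrite (metric_sym (f t) (g (F t))) (metric_sym (f s) (g (F s))).
by move=> *; apply/andP; split; lra.
Qed.

Lemma lt_of_lt_invM (R : realType) (c r : R) (x : \bar R) :
  0 < c -> (r%:E < c^-1%:E * x -> (c * r)%:E < x)%E.
Proof.
by move=> c0; rewrite lte_pdivlMl// EFinM.
Qed.
Unset Implicit Arguments.

Theorem theorem6 (R : realType) (T : metricType R) (G : finite_metric_graph T)
    (treeG : is_metric_tree G) (X : set T) :
  (Order.min ((2%:R^-1)%:E * hausdorff_dist [set: T] X)
     (Order.min ((4%:R^-1)%:E * shortest_leaf_edge G)
        ((2%:R^-1)%:E * sep (leaf_dists G)))
   <= gromov_hausdorff_dist [set: T] X)%E.
Proof.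
rewrite leNgt; apply/negP => /ereal_inf_lt[_ [Z [f [g [isof isog ->]]]]].
move=> /ereal_inf_lt[_ [r [r0 fg gf] <-]]; rewrite !lt_min => /and3P[].
move=> /lt_of_lt_invM -/(_ (ltr0n R 2)) rdH.
move=> /lt_of_lt_invM -/(_ (ltr0n R 4)) rlen.
move=> /lt_of_lt_invM -/(_ (ltr0n R 2)) rsep.
have r20 : 0 < 2 * r by lra.
have [F [XF Fg Fr]] := coarse_map_of_hausdorff isof isog fg.
(* Without such a point [2 * r] would be an admissible radius for the Hausdorff distance of [T] and
   [X]. *)
have [p pX] : exists p, forall x, X x -> 2 * r <= mdist p x.
  apply: contrapT => near_pt.
  suff : (hausdorff_dist [set: T] X <= (2 * r)%:E)%E by rewrite leNgt rdH.
  apply: ereal_inf_lbound; exists (2 * r) => //; split => //.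
    move=> p _; apply: contrapT => pX; apply: near_pt; exists p => x Xx.
    rewrite leNgt; apply/negP => px; apply: pX; exists x => //.
    by rewrite ballEmdist /= metric_sym.
  by move=> x _; exists x => //; rewrite ballEmdist /= mdistxx.
have [|||x Xx] := no_coarse_isometry_off_point p treeG r20 _ _ XF Fr.
- move=> e leaf_e; have : ((4 * r)%:E < (len G e)%:E)%E.
    by apply: lt_le_trans rlen _; apply: ereal_inf_lbound; exists e.
  by rewrite lte_fin; lra.
- move=> y y' Yy Yy' yy'; rewrite -lee_fin; apply/ltW/(lt_le_trans rsep).
  by apply: ereal_inf_lbound; exists y, y'.
(* In [Z], both [g x] and [g (F t)] are within [r] of [f t]. *)
- move=> x Xx; have [|_ [t _ <-] xt] := gf (g x); first by exists x.
  exists t; rewrite ballEmdist /= in xt; rewrite -isog//.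
  have := metric_triangle (g x) (f t) (g (F t)).
  by have := Fg t; rewrite (metric_sym (f t) (g x)) (metric_sym (f t)) in xt *; lra.
- by rewrite ltNge pX.
Qed.
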